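(* $\mathsf{D}^2\le\mathsf{IF}^2\le\mathsf{D}^3$. That is, for every sentence $\phi$ of $\mathsf{D}^2$ there is a sentence $\phi^*$ of $\mathsf{IF}^2$ such that $\mathfrak{A}\models\phi$ iff $\mathfrak{A}\models\phi^*$ for all structures $\mathfrak{A}$, and for every sentence $\phi$ of $\mathsf{IF}^2$ there is a sentence $\phi^*$ of $\mathsf{D}^3$ such that $\mathfrak{A}\models\phi$ iff $\mathfrak{A}\models\phi^*$ for all structures $\mathfrak{A}$.
   Context: Syntax, over a relational vocabulary $\tau$ whose symbols are at most binary. Fix variables $x,y$. Formulas of $\mathsf{D}^2(\tau)$ (two-variable dependence logic) are generated by $\phi::= t_1=t_2\mid R(t_1,\dots,t_n)\mid \neg t_1=t_2\mid \neg R(t_1,\dots,t_n)\mid =\!(t_1,t_2)\mid \neg =\!(t_1,t_2)\mid =\!(t_1)\mid\neg =\!(t_1)\mid(\phi\wedge\phi)\mid(\phi\vee\phi)\mid\forall x\phi\mid\forall y\phi\mid\exists x\phi\mid\exists y\phi$. Formulas of $\mathsf{IF}^2(\tau)$ (two-variable independence-friendly logic) are generated by $\phi::= t_1=t_2\mid R(t_1,\dots,t_n)\mid \neg t_1=t_2\mid \neg R(t_1,\dots,t_n)\mid(\phi\wedge\phi)\mid(\phi\vee\phi)\mid\forall x\phi\mid\forall y\phi\mid\exists x/W\phi\mid\exists y/W\phi$. Here $R\in\tau$ is $n$-ary, $t_1,\dots,t_n\in\{x,y\}$ and $W\subseteq\{x,y\}$; $\exists x/\emptyset\,\phi$ is identified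 with $\exists x\phi$. Formulas of $\mathsf{D}^3(\tau)$ are the dependence logic formulas, in negation normal form, in which only variables $x,y,z$ occur: they are built from first-order literals over $\tau$ (including equality literals), dependence atoms $=\!(t_1,\dots,t_n)$ and their negations with terms in $\{x,y,z\}$, using $\wedge,\vee$ and $\forall v,\exists v$ with $v\in\{x,y,z\}$. Free variables $\mathrm{Fr}(\phi)$ are defined as in first-order logic, with $\mathrm{Fr}(=\!(t_1,\dots,t_n))$ the set of variables occurring in $t_1,\dots,t_n$ and $\mathrm{Fr}(\exists v/W\psi)=W\cup(\mathrm{Fr}(\psi)\setminus\{v\})$. A sentence is a formula with no free variables. Teams. A team $X$ of $\mathfrak{A}$ (domain $A$) with domain $\mathrm{dom}(X)=\{x_1,\dots,x_k\}$ (possibly empty) is any set of assignments $\{x_1,\dots,x_k\}\to A$. The assignment $s(a/x)$ has domain $\mathrm{dom}(s)\cup\{x\}$, maps $x$ to $a$ and agrees with $s$ elsewhere. For $F\colon X\to A$, $X(F/x)=\{s(F(s)/x)\mid s\in X\}$, and $X(A/x)=\{s(a/x)\mid s\in X,a\in A\}$. For $W\subseteq\mathrm{dom}(X)$, $F\colon X\to A$ is $W$-independent if $F(s)=F(s')$ whenever $s,s'\in X$ agree on $\mathrm{dom}(X)\setminus W$. Semantics (with $\mathrm{Fr}(\phi)\subseteq\mathrm{dom}(X)$). (1) For a first-order literal $\phi$: $\mathfrak{A}\models_X\phi$ iff every $s\in X$ satisfies $\phi$ in $\mathfrak{A}$ in the usual sense. (2) $\mathfrak{A}\models_X\psi\wedge\phi$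 iff $\mathfrak{A}\models_X\psi$ and $\mathfrak{A}\models_X\phi$. (3) $\mathfrak{A}\models_X\psi\vee\phi$ iff $X=Y\cup Z$ for some teams $Y,Z$ with $\mathfrak{A}\models_Y\psi$ and $\mathfrak{A}\models_Z\phi$. (4) $\mathfrak{A}\models_X\exists v\psi$ iff $\mathfrak{A}\models_{X(F/v)}\psi$ for some $F\colon X\to A$. (5) $\mathfrak{A}\models_X\forall v\psi$ iff $\mathfrak{A}\models_{X(A/v)}\psi$. (6) $\mathfrak{A}\models_X\exists v/W\psi$ iff $\mathfrak{A}\models_{X(F/v)}\psi$ for some $W$-independent $F\colon X\to A$. (7) $\mathfrak{A}\models_X{=}(t_1,\dots,t_n)$ iff any $s,s'\in X$ that give equal values to each of $t_1,\dots,t_{n-1}$ give equal values to $t_n$. (8) $\mathfrak{A}\models_X\neg{=}(t_1,\dots,t_n)$ iff $X=\emptyset$. A sentence $\phi$ is true in $\mathfrak{A}$, $\mathfrak{A}\models\phi$, if $\mathfrak{A}\models_{\{\emptyset\}}\phi$, where $\{\emptyset\}$ is the team consisting of the empty assignment. *)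

(* Defs.v *)
From mathcomp Require Import all_boot.

Set Implicit Arguments.
Unset Strict Implicit.
Unset Printing Implicit Defensive.

Record vocabulary := Vocabulary { symb : Type; arity : symb -> nat }.

Definition at_most_binary (tau : vocabulary) : Prop :=
  forall R : symb tau, arity R <= 2.

(* The carrier is an arbitrary type; it is not required to be inhabited. *)
Record structure (tau : vocabulary) := Structure {
  carrier : Type;
  interp : forall R : symb tau, (arity R).-tuple carrier -> Prop
}.

(* The variables of a k-variable logic are the elements of 'I_k: x, y are the
   two elements of 'I_2 and x, y, z are the three elements of 'I_3. *)

Inductive literal (tau : vocabulary) (k : nat) : Type :=
  | LEq of 'I_k & 'I_k
  | LNeq of 'I_k & 'I_k
  | LRel (R : symb tau) of (arity R).-tuple 'I_k
  | LNRel (R : symb tau) of (arity R).-tuple 'I_k.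

(* [DDep ts t] is the atom =(t_1, ..., t_n) with t_1, ..., t_(n-1) listed in
   [ts] and t_n = [t]; thus n = (size ts).+1 >= 1.  [DNDep] is its negation. *)
Inductive dform (tau : vocabulary) (k : nat) : Type :=
  | DLit of literal tau k
  | DDep of seq 'I_k & 'I_k
  | DNDep of seq 'I_k & 'I_k
  | DAnd of dform tau k & dform tau k
  | DOr of dform tau k & dform tau k
  | DAll of 'I_k & dform tau k
  | DEx of 'I_k & dform tau k.

(* [IEx v W phi] is the slashed quantifier "exists v / W". *)
Inductive ifform (tau : vocabulary) (k : nat) : Type :=
  | ILit of literal tau k
  | IAnd of ifform tau k & ifform tau k
  | IOr of ifform tau k & ifform tau k
  | IAll of 'I_k & ifform tau k
  | IEx of 'I_k & {set 'I_k} & ifform tau k.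

(* All dependence atoms =(t_1, ..., t_n) and their negations have n <= m.
   D^2 is the set of [phi : dform tau 2] with [dep_width_le 2 phi]; D^3 is the
   whole of [dform tau 3]. *)
Fixpoint dep_width_le (m : nat) tau k (phi : dform tau k) : bool :=
  match phi with
  | DLit _ => true
  | DDep ts _ | DNDep ts _ => (size ts).+1 <= m
  | DAnd p q | DOr p q => dep_width_le m p && dep_width_le m q
  | DAll _ p | DEx _ p => dep_width_le m p
  end.

Definition lit_fr tau k (l : literal tau k) : {set 'I_k} :=
  match l with
  | LEq t u | LNeq t u => [set t; u]
  | LRel _ ts | LNRel _ ts => [set v in ts]
  end.

Fixpoint dfr tau k (phi : dform tau k) : {set 'I_k} :=
  match phi with
  | DLit l => lit_fr l
  | DDep ts t | DNDep ts t => [set v in rcons ts t]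
  | DAnd p q | DOr p q => dfr p :|: dfr q
  | DAll v p | DEx v p => dfr p :\ v
  end.

Fixpoint iffr tau k (phi : ifform tau k) : {set 'I_k} :=
  match phi with
  | ILit l => lit_fr l
  | IAnd p q | IOr p q => iffr p :|: iffr q
  | IAll v p => iffr p :\ v
  | IEx v W p => W :|: (iffr p :\ v)
  end.

Definition dsentence tau k (phi : dform tau k) : Prop := dfr phi = set0.
Definition ifsentence tau k (phi : ifform tau k) : Prop := iffr phi = set0.

(* A (partial) assignment; its domain is the set of v with [s v <> None]. *)
Definition asg (A : Type) (k : nat) := {ffun 'I_k -> option A}.

Definition asg_dom A k (s : asg A k) : {set 'I_k} := [set v | s v].

Definition empty_asg A k : asg A k := [ffun=> None].

Definition upd A k (s : asg A k) (v : 'I_k) (a : A) : asg A k :=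
  [ffun u => if u == v then Some a else s u].

Lemma asg_dom_empty A k : asg_dom (empty_asg A k) = set0.
Proof. by apply/setP=> v; rewrite !inE ffunE. Qed.

Lemma asg_dom_upd A k (s : asg A k) v a :
  asg_dom (upd s v a) = v |: asg_dom s.
Proof. by apply/setP=> u; rewrite !inE ffunE; case: (u == v). Qed.

(* The domain is part of the team, so that the empty set of assignments is a
   team with any prescribed domain. *)
Record team (A : Type) (k : nat) := Team {
  tdom : {set 'I_k};
  tmem :> asg A k -> Prop;
  tmem_dom : forall s, tmem s -> asg_dom s = tdom
}.

Lemma unit_team_dom A k (s : asg A k) : s = empty_asg A k -> asg_dom s = set0.
Proof. by move=> ->; exact: asg_dom_empty. Qed.

(* The team whose only element is the empty assignment. *)
Definition unit_team A k : team A k := Team (@unit_team_dom A k).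

(* A function F : X -> A is represented by a partial function on assignments
   that is defined on X. *)
Definition defined_on A k (X : team A k) (F : asg A k -> option A) : Prop :=
  forall s, X s -> F s.

Definition independent A k (X : team A k) (W : {set 'I_k})
    (F : asg A k -> option A) : Prop :=
  forall s s', X s -> X s' ->
    (forall v, v \in tdom X :\: W -> s v = s' v) -> F s = F s'.

Lemma supplement_dom A k (X : team A k) (F : asg A k -> option A) v s' :
  (exists s a, [/\ X s, F s = Some a & s' = upd s v a]) ->
  asg_dom s' = v |: tdom X.
Proof. by case=> s [a [Xs _ ->]]; rewrite asg_dom_upd (tmem_dom Xs). Qed.

(* X(F/v) *)
Definition supplement A k (X : team A k) (F : asg A k -> option A) (v : 'I_k) :
  team A k := Team (@supplement_dom A k X F v).

Lemma duplicate_dom A k (X : team A k) v s' :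
  (exists s a, X s /\ s' = upd s v a) -> asg_dom s' = v |: tdom X.
Proof. by case=> s [a [Xs ->]]; rewrite asg_dom_upd (tmem_dom Xs). Qed.

(* X(A/v) *)
Definition duplicate A k (X : team A k) (v : 'I_k) : team A k :=
  Team (@duplicate_dom A k X v).

Definition is_union A k (X Y Z : team A k) : Prop :=
  [/\ tdom Y = tdom X, tdom Z = tdom X & forall s, X s <-> Y s \/ Z s].

(* Only meaningful when the variables of the literal are in the domain of s. *)
Definition rel_holds tau (M : structure tau) k (s : asg (carrier M) k)
    (R : symb tau) (ts : (arity R).-tuple 'I_k) : Prop :=
  exists2 b : (arity R).-tuple (carrier M),
    map_tuple s ts = map_tuple Some b & interp b.

Definition lit_holds tau (M : structure tau) k (s : asg (carrier M) k)
    (l : literal tau k) : Prop :=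
  match l with
  | LEq t u => s t = s u
  | LNeq t u => s t <> s u
  | LRel _ ts => rel_holds s ts
  | LNRel _ ts => ~ rel_holds s ts
  end.

Fixpoint dsat tau (M : structure tau) k (X : team (carrier M) k)
    (phi : dform tau k) : Prop :=
  match phi with
  | DLit l => forall s, X s -> lit_holds s l
  | DDep ts t => forall s s', X s -> X s' ->
      (forall u, u \in ts -> s u = s' u) -> s t = s' t
  | DNDep _ _ => forall s, ~ X s
  | DAnd p q => dsat X p /\ dsat X q
  | DOr p q => exists Y Z, [/\ is_union X Y Z, dsat Y p & dsat Z q]
  | DAll v p => dsat (duplicate X v) p
  | DEx v p => exists2 F, defined_on X F & dsat (supplement X F v) p
  end.

Fixpoint ifsat tau (M : structure tau) k (X : team (carrier M) k)
    (phi : ifform tau k) : Prop :=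
  match phi with
  | ILit l => forall s, X s -> lit_holds s l
  | IAnd p q => ifsat X p /\ ifsat X q
  | IOr p q => exists Y Z, [/\ is_union X Y Z, ifsat Y p & ifsat Z q]
  | IAll v p => ifsat (duplicate X v) p
  | IEx v W p => exists F,
      [/\ defined_on X F, independent X W F & ifsat (supplement X F v) p]
  end.

Definition dtrue tau (M : structure tau) k (phi : dform tau k) : Prop :=
  dsat (unit_team (carrier M) k) phi.

Definition iftrue tau (M : structure tau) k (phi : ifform tau k) : Prop :=
  ifsat (unit_team (carrier M) k) phi.

(* Main.v *)
Require Import Defs.
From mathcomp Require Import all_boot.
From Stdlib Require Import Classical_Prop IndefiniteDescription.

(** D^2 <= IF^2: over a team X, the atom [=(u,t)] says that the value of [t] is
    given by a choice function reading only [u], that is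
    [exists u/(dom X \ u) (u = t)]; similarly [=(t)] is [exists u/dom X (u = t)]
    for any [u] other than [t].

    IF^2 <= D^3: [exists v/W phi] over a team of domain V becomes
    [exists z (=(V \ W, z) /\ exists v (v = z /\ phi))].  The spare variable [z]
    holds the new value of [v] while the old value, on which the choice may
    depend, is still available.  Afterwards [z] is junk: a formula and its
    translation agree on X and Y as soon as X is the projection of Y that
    forgets [z].  Both translations carry the current team domain V along. *)

Set Implicit Arguments.
Unset Strict Implicit.
Unset Printing Implicit Defensive.

(** * From dependence atoms to slashed quantifiers *)

Section DependenceToIF.

Variables (tau : vocabulary) (k : nat).

(** Having at least two variables makes [lift t ord0] a variable other than [t]. Dropping the tail
    after [u] is faithful for atoms of width at most two. If [u == t] the atom holds trivially; a
    negated atom becomes a literal that no assignment satisfies, so only the empty team does. *)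
Fixpoint if_of_dep (V : {set 'I_k.+2}) (phi : dform tau k.+2) :
    ifform tau k.+2 :=
  match phi with
  | DLit l => ILit l
  | DDep [::] t =>
      IEx (lift t ord0) V (ILit (LEq tau (lift t ord0) t))
  | DDep (u :: _) t =>
      if u == t then ILit (LEq tau t t)
      else IEx u (V :\ u) (ILit (LEq tau u t))
  | DNDep _ t => ILit (LNeq tau t t)
  | DAnd p q => IAnd (if_of_dep V p) (if_of_dep V q)
  | DOr p q => IOr (if_of_dep V p) (if_of_dep V q)
  | DAll v p => IAll v (if_of_dep (v |: V) p)
  | DEx v p => IEx v set0 (if_of_dep (v |: V) p)
  end.

Lemma if_of_dep_fr (phi : dform tau k.+2) (V : {set 'I_k.+2}) :
  dfr phi \subset V -> iffr (if_of_dep V phi) \subset V.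
Proof.
elim: phi V => [l|ts t|ts t|p IHp q IHq|p IHp q IHq|v p IHp|v p IHp] V //=.
- move=> frV; have tV : t \in V.
    by apply: (subsetP frV); rewrite inE mem_rcons mem_head.
  case: ts frV => [|u ts] frV /=.
    rewrite subUset subxx /=; apply/subsetP => w.
    by rewrite !inE => /andP[/negPf ->] /eqP ->.
  case: eqVneq => [_|_] /=; first by rewrite subUset !sub1set tV.
  rewrite subUset subD1set /=; apply/subsetP => w.
  by rewrite !inE => /andP[/negPf ->] /eqP ->.
- move/subsetP/(_ t); rewrite inE mem_rcons mem_head => /(_ isT) tV.
  by rewrite subUset !sub1set tV.
- by rewrite !subUset => /andP[/IHp -> /IHq ->].
- by rewrite !subUset => /andP[/IHp -> /IHq ->].
- by rewrite !subDset => /IHp.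
- by rewrite set0U !subDset => /IHp.
Qed.

Variable M : structure tau.
Implicit Type X : team (carrier M) k.+2.

Lemma team_defined X s v : X s -> v \in tdom X -> s v.
Proof. by move=> /tmem_dom <-; rewrite inE. Qed.

(** Assignments of one team are all undefined outside its domain, so agreement on the whole domain
    makes them equal. Hence slashing by [set0] costs nothing. *)
Lemma independent_set0 X F : independent X set0 F.
Proof.
move=> s s' Xs Xs' eq_ss'; congr F; apply/ffunP => v.
have [vX|] := boolP (v \in tdom X); first by apply: eq_ss'; rewrite setD0.
rewrite -{1}(tmem_dom Xs) inE => Ns.
have: v \notin tdom X by rewrite -(tmem_dom Xs) inE.
by rewrite -(tmem_dom Xs') inE; case: (s v) Ns; case: (s' v).
Qed.

(** The literal forces the chosen value to be [s t], so a single candidate function remains. As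
    [u != t], overwriting [u] leaves [t] intact. *)
Lemma slashed_copyP X (W : {set 'I_k.+2}) u t : t \in tdom X -> u != t ->
  ifsat X (IEx u W (ILit (LEq tau u t))) <-> independent X W (fun s => s t).
Proof.
move=> tX ut; split=> /= [[F [Fdef Find Fsat]] s s' Xs Xs' eq_ss'|ind].
  have FE r : X r -> F r = r t.
    move=> Xr; have := Fdef r Xr; case EF: (F r) => [a|//] _.
    have := Fsat (upd r u a) (ex_intro _ r (ex_intro _ a (And3 Xr EF erefl))).
    by rewrite !ffunE eqxx eq_sym (negPf ut).
  by rewrite -FE // -FE //; apply: Find.
exists (fun s => s t); split=> // [s Xs|_ [s [a [Xs st ->]]]].
  exact: team_defined Xs tX.
by rewrite !ffunE eqxx eq_sym (negPf ut) st.
Qed.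

Lemma if_of_depP (phi : dform tau k.+2) X :
  dep_width_le 2 phi -> dfr phi \subset tdom X ->
  dsat X phi <-> ifsat X (if_of_dep (tdom X) phi).
Proof.
elim: phi X => [l|ts t|ts t|p IHp q IHq|p IHp q IHq|v p IHp|v p IHp] X //=.
- move=> w2 /subsetP frV; have tV : t \in tdom X.
    by apply: frV; rewrite inE mem_rcons mem_head.
  case: ts w2 frV => [|u [|//]] _ frV.
    (* The whole domain is slashed, so independence amounts to constancy of [t]. *)
    rewrite slashed_copyP 1?eq_sym ?neq_lift //.
    split=> dep s s' Xs Xs' eq_ss'; apply: dep => // v.
    by rewrite setDv inE.
  have uV : u \in tdom X by apply: frV; rewrite inE mem_head.
  case: eqVneq => [->|ut].
    by split=> // _ s s' _ _; apply; rewrite mem_head.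
  rewrite (slashed_copyP _ tV ut).
  (* Since [u] lies in the domain, removing [tdom X :\ u] from it leaves exactly [u]. *)
  split=> dep s s' Xs Xs' eq_ss'; apply: dep => // v.
    by rewrite inE => /eqP ->; apply: eq_ss'; rewrite !inE eqxx.
  by rewrite !inE negb_and negbK => /andP[/orP[/eqP ->|/negPf ->]] // _;
     apply: eq_ss'; rewrite mem_head.
- by move=> _ _; split=> [X0 s /X0|X0 s Xs]//; apply: (X0 s Xs).
- rewrite subUset => /andP[wp wq] /andP[fp fq].
  by rewrite (IHp X) // (IHq X).
- rewrite subUset => /andP[wp wq] /andP[fp fq].
  split=> -[Y [Z [[dY dZ XYZ] sp sq]]]; exists Y, Z; split=> //.
  + by rewrite -dY -IHp ?dY.
  + by rewrite -dZ -IHq ?dZ.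
  + by rewrite IHp ?dY.
  + by rewrite IHq ?dZ.
- by rewrite subDset => wp fp; rewrite (IHp (duplicate X v)).
- rewrite subDset => wp fp; split=> [[F Fdef]|[F [Fdef _]]].
    rewrite (IHp (supplement X F v)) // => sp; exists F; split=> //.
    exact: independent_set0.
  by rewrite -(IHp (supplement X F v)) // => sp; exists F.
Qed.

End DependenceToIF.

(** * Replacing slashes by dependence atoms on a spare variable *)

Section IFToDependence.

Variable k : nat.

(** The image of [emb] is every variable except [ord_max], which serves as the spare variable z. *)
Local Notation emb := (lift (@ord_max k)).

Lemma emb_neq_max (i : 'I_k) : (emb i == ord_max) = false.
Proof. by rewrite eq_sym (negPf (neq_lift _ _)). Qed.

Definition emb_lit tau (l : literal tau k) : literal tau k.+1 :=
  match l with
  | LEq t u => LEq tau (emb t) (emb u)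
  | LNeq t u => LNeq tau (emb t) (emb u)
  | LRel R ts => LRel (map_tuple emb ts)
  | LNRel R ts => LNRel (map_tuple emb ts)
  end.

Lemma emb_lit_fr tau (l : literal tau k) : lit_fr (emb_lit l) = emb @: lit_fr l.
Proof.
case: l => [t u|t u|R ts|R ts] /=; rewrite ?imsetU1 ?imset_set1 //;
  apply/setP => j; rewrite inE; apply/mapP/imsetP => -[i];
  by rewrite ?inE => ? ->; exists i; rewrite ?inE.
Qed.

Fixpoint dep_of_if tau (V : {set 'I_k}) (phi : ifform tau k) :
    dform tau k.+1 :=
  match phi with
  | ILit l => DLit (emb_lit l)
  | IAnd p q => DAnd (dep_of_if V p) (dep_of_if V q)
  | IOr p q => DOr (dep_of_if V p) (dep_of_if V q)
  | IAll v p => DAll (emb v) (dep_of_if (v |: V) p)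
  | IEx v W p =>
      DEx ord_max
        (DAnd (DDep tau (map emb (enum (V :\: W))) ord_max)
              (DEx (emb v) (DAnd (DLit (LEq tau (emb v) ord_max))
                                 (dep_of_if (v |: V) p))))
  end.

Lemma dep_of_if_fr tau (phi : ifform tau k) (V : {set 'I_k}) :
  iffr phi \subset V -> dfr (dep_of_if V phi) \subset emb @: V.
Proof.
elim: phi V => [l|p IHp q IHq|p IHp q IHq|v p IHp|v W p IHp] V /=.
- by rewrite emb_lit_fr; apply: imsetS.
- by rewrite !subUset => /andP[/IHp -> /IHq ->].
- by rewrite !subUset => /andP[/IHp -> /IHq ->].
- by rewrite !subDset -imsetU1 => /IHp.
- rewrite subUset subDset => /andP[WV /IHp]; rewrite imsetU1 => frp.
  rewrite subDset !subUset; apply/andP; split.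
    apply/subsetP => j; rewrite inE mem_rcons inE in_setU1.
    case: eqP => //= _ /mapP[i]; rewrite mem_enum inE => /andP[_ iV] ->.
    exact: imset_f.
  rewrite subDset !subUset !sub1set !inE !eqxx ?orbT /=.
  by apply: subset_trans frp _; rewrite setUCA subsetUr.
Qed.

(** * Teams related by forgetting the spare variable *)

Variable A : Type.

Definition forget (t : asg A k.+1) : asg A k := [ffun i => t (emb i)].

Lemma forgetE t i : forget t i = t (emb i).
Proof. by rewrite ffunE. Qed.

Lemma forget_upd t v a : forget (upd t (emb v) a) = upd (forget t) v a.
Proof. by apply/ffunP => i; rewrite !ffunE (inj_eq lift_inj). Qed.

Lemma forget_upd_max t a : forget (upd t ord_max a) = forget t.
Proof. by apply/ffunP => i; rewrite !ffunE emb_neq_max. Qed.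

Lemma asg_dom_forget t : asg_dom (forget t) = emb @^-1: asg_dom t.
Proof. by apply/setP => i; rewrite !inE ffunE. Qed.

(** Whether [ord_max] belongs to [tdom Y] is left open: it enters only at the first existential
    quantifier. One member of [X] may come from several members of [Y]. *)
Definition projects (X : team A k) (Y : team A k.+1) : Prop :=
  tdom X = emb @^-1: tdom Y /\
  forall s, X s <-> exists2 t, Y t & s = forget t.

Lemma projects_mem X Y t : projects X Y -> Y t -> X (forget t).
Proof. by case=> _ XY Yt; apply/XY; exists t. Qed.

Lemma preim_embU1 v (B : {set 'I_k.+1}) :
  emb @^-1: (emb v |: B) = v |: emb @^-1: B.
Proof. by apply/setP => i; rewrite !inE (inj_eq lift_inj). Qed.

Lemma preim_embU1_max (B : {set 'I_k.+1}) :
  emb @^-1: (ord_max |: B) = emb @^-1: B.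
Proof. by apply/setP => i; rewrite !inE emb_neq_max. Qed.

Lemma projects_unit : projects (unit_team A k) (unit_team A k.+1).
Proof.
have E : empty_asg A k = forget (empty_asg A k.+1).
  by apply/ffunP => i; rewrite !ffunE.
split=> [|s]; first by apply/setP => i; rewrite !inE.
by split=> [->|[t -> ->]]; [exists (empty_asg A k.+1)|].
Qed.

Lemma projects_duplicate X Y v :
  projects X Y -> projects (duplicate X v) (duplicate Y (emb v)).
Proof.
case=> dXY XY; split=> [|s] /=; first by rewrite preim_embU1 dXY.
split=> [[r [a [/XY[t Yt ->] ->]]]|[_ [t [a [Yt ->]]] ->]].
  by exists (upd t (emb v) a); rewrite ?forget_upd //; exists t, a.
by exists (forget t), a; rewrite forget_upd; split=> //; apply/XY; exists t.
Qed.

(* [Y (G / z) (z / v)] projects to [X (F / v)] whenever G computes F. *)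
Lemma projects_supplement X Y F G H v :
  projects X Y -> (forall t, Y t -> G t = F (forget t)) ->
  (forall t, supplement Y G ord_max t -> H t = t ord_max) ->
  projects (supplement X F v)
           (supplement (supplement Y G ord_max) H (emb v)).
Proof.
case=> dXY XY GF Hz; split=> [|s] /=.
  by rewrite preim_embU1 preim_embU1_max dXY.
split=> [[r [a [/XY[t Yt ->] Fa ->]]]|].
  have Yt' : supplement Y G ord_max (upd t ord_max a).
    by exists t, a; rewrite GF.
  exists (upd (upd t ord_max a) (emb v) a).
    exists (upd t ord_max a), a; split=> //.
    by rewrite Hz // ffunE eqxx.
  by rewrite forget_upd forget_upd_max.
case=> _ [t' [a [Yt' Ht' ->]]] ->; have := Hz t' Yt'; rewrite Ht'.
case: Yt' => t [b [Yt Gt t'E]]; rewrite t'E ffunE eqxx => -[ab].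
exists (forget t), a; split; first by apply/XY; exists t.
  by rewrite -GF // Gt ab.
by rewrite forget_upd forget_upd_max.
Qed.

Lemma project_dom (Y : team A k.+1) s :
  (exists2 t, Y t & s = forget t) -> asg_dom s = emb @^-1: tdom Y.
Proof. by case=> t Yt ->; rewrite asg_dom_forget (tmem_dom Yt). Qed.

(** The image under [forget] carries splits of [Y] down to [X]; the preimage [lift_sub] carries
    splits of [X] up to [Y]. *)
Definition project (Y : team A k.+1) : team A k := Team (@project_dom Y).

Lemma lift_sub_dom (X : team A k) (Y : team A k.+1) t :
  Y t /\ X (forget t) -> asg_dom t = tdom Y.
Proof. by case=> /tmem_dom. Qed.

Definition lift_sub X Y : team A k.+1 := Team (@lift_sub_dom X Y).

(** The inclusion of [X'] in [X] guarantees that each member of [X'] has a lift in [Y]. *)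
Lemma projects_lift_sub X X' Y :
  projects X Y -> tdom X' = tdom X -> (forall s, X' s -> X s) ->
  projects X' (lift_sub X' Y).
Proof.
case=> dXY XY dX sub; split=> [|s]; first by rewrite dX dXY.
split=> [X's|[t [Yt X't] ->]//].
by have [t Yt st] := (XY s).1 (sub s X's); exists t => //; split=> //; rewrite -st.
Qed.

Lemma projects_union X Y : projects X Y -> forall Y1 Y2,
  is_union Y Y1 Y2 -> is_union X (project Y1) (project Y2).
Proof.
case=> dXY XY Y1 Y2 [d1 d2 Y12]; split=> /= [||s]; rewrite ?d1 ?d2 ?dXY //.
rewrite XY; split=> [[t /Y12[] Yt ->]|[] [t Yt ->]].
- by left; exists t.
- by right; exists t.
- by exists t => //; apply/Y12; left.
- by exists t => //; apply/Y12; right.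
Qed.

Lemma lift_sub_union X Y : projects X Y -> forall X1 X2,
  is_union X X1 X2 -> is_union Y (lift_sub X1 Y) (lift_sub X2 Y).
Proof.
move=> XY X1 X2 [d1 d2 X12]; split=> // t /=.
split=> [Yt|[] []//]; have /X12[] := projects_mem XY Yt; tauto.
Qed.

(* Every assignment in X extends to some member of Y; choosing one transports a
   choice function on Y to one on X. *)
Lemma projects_section X Y : projects X Y ->
  exists e : asg A k -> asg A k.+1, forall s, X s -> Y (e s) /\ s = forget (e s).
Proof.
case=> _ XY.
have ex s : exists t, X s -> Y t /\ s = forget t.
  have [/XY[t Yt st]|NXs] := classic (X s); first by exists t.
  (* Outside [X] any default will do; the empty assignment exists even when [A] is empty. *)
  by exists (empty_asg A k.+1).
by exists (fun s => proj1_sig (constructive_indefinite_description _ (ex s)))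
     => s; case: constructive_indefinite_description.
Qed.

End IFToDependence.

(** * Correctness of the translation into dependence logic *)

Section IFToDependenceCorrect.

Variables (tau : vocabulary) (k : nat) (M : structure tau).
Local Notation emb := (lift (@ord_max k)).

Lemma emb_litP (t : asg (carrier M) k.+1) (l : literal tau k) :
  lit_holds t (emb_lit l) <-> lit_holds (forget t) l.
Proof.
have relE R (ts : (arity R).-tuple 'I_k) :
    rel_holds t (map_tuple emb ts) <-> rel_holds (M := M) (forget t) ts.
  have E : map_tuple t (map_tuple emb ts) = map_tuple (forget t) ts.
    by apply/val_inj; rewrite /= -map_comp; apply: eq_map => i; rewrite ffunE.
  by rewrite /rel_holds E.
by case: l => [u v|u v|R ts|R ts] /=; rewrite ?forgetE ?relE.
Qed.

(** Upwards, [F] is composed with [forget]. Downwards, the dependence atom makes [G] blind to the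
    slashed variables and to old values of [ord_max], so [G] descends to [X]. *)
Lemma slash_elimP (X : team (carrier M) k) (Y : team (carrier M) k.+1) v W
    (p : ifform tau k) (q : dform tau k.+1) :
  projects X Y ->
  (forall (X' : team (carrier M) k) (Y' : team (carrier M) k.+1),
     tdom X' = v |: tdom X -> projects X' Y' -> ifsat X' p <-> dsat Y' q) ->
  ifsat X (IEx v W p) <->
  dsat Y (DEx ord_max
           (DAnd (DDep tau (map emb (enum (tdom X :\: W))) ord_max)
                 (DEx (emb v) (DAnd (DLit (LEq tau (emb v) ord_max)) q)))).
Proof.
move=> XY IH; split=> /= [[F [Fdef Find Fsat]]|[G Gdef [Gdep [H Hdef [Heq Hsat]]]]].
  exists (fun t => F (forget t)) => [t Yt|].
    by apply: Fdef; apply: projects_mem Yt.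
  split=> [s s' [t [a [Yt Ft ->]]] [t' [a' [Yt' Ft' ->]]] eq_tt'|].
    rewrite !ffunE eqxx -Ft -Ft'.
    apply: Find => [||i iD]; [exact: projects_mem Yt|exact: projects_mem Yt'|].
    rewrite !ffunE.
    have := eq_tt' (emb i); rewrite !ffunE emb_neq_max; apply.
    by apply: map_f; rewrite mem_enum.
  exists (fun t => t ord_max) => [_ [t [a [_ _ ->]]]|].
    by rewrite ffunE eqxx.
  split=> [_ [s [a [_ sa ->]]]|].
    by rewrite !ffunE eqxx eq_sym emb_neq_max sa.
  by apply/(IH (supplement X F v)) => //; apply: projects_supplement.
have [e eP] := projects_section XY.
(* The atom speaks of assignments already updated at [ord_max]; the update leaves the embedded
   variables alone, so the constraint holds for [G] on [Y] itself. *)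
have Gag t t' : Y t -> Y t' ->
    (forall i, i \in tdom X :\: W -> t (emb i) = t' (emb i)) -> G t = G t'.
  move=> Yt Yt' eq_tt'; have := Gdef t Yt; have := Gdef t' Yt'.
  case Gt': (G t') => [a'|//] _; case Gt: (G t) => [a|//] _.
  have := Gdep (upd t ord_max a) (upd t' ord_max a').
  rewrite !ffunE eqxx; apply; [by exists t, a|by exists t', a'|].
  move=> _ /mapP[i iD ->]; rewrite !ffunE emb_neq_max.
  by apply: eq_tt'; rewrite -mem_enum.
exists (fun s => G (e s)); split=> [s Xs|s s' Xs Xs' eq_ss'|].
- by apply: Gdef; have [] := eP s Xs.
- have [Yt sE] := eP s Xs; have [Yt' sE'] := eP s' Xs'.
  by apply: Gag => // i iD; rewrite -!forgetE -sE -sE'; apply: eq_ss'.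
apply: (iffRL (IH _ _ _ _) Hsat) => //.
apply: projects_supplement => // [t Yt|t Yt].
  (* [t] and its chosen representative [e (forget t)] can differ only at [ord_max], which [G]
     ignores. *)
  have [Ye tE] := eP _ (projects_mem XY Yt).
  by apply: Gag => // i _; rewrite -!forgetE -tE.
(* The equality literal forces [H] to copy the value of [ord_max]. *)
have := Hdef t Yt; case Ht: (H t) => [a|//] _.
have := Heq (upd t (emb v) a) (ex_intro _ t (ex_intro _ a (And3 Yt Ht erefl))).
by rewrite !ffunE eqxx eq_sym emb_neq_max.
Qed.

(** Allowing every [Y] that projects to [X] lets the induction absorb whatever values remain in
    [ord_max]. *)
Lemma dep_of_ifP (phi : ifform tau k) (X : team (carrier M) k)
    (Y : team (carrier M) k.+1) :
  projects X Y -> ifsat X phi <-> dsat Y (dep_of_if (tdom X) phi).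
Proof.
elim: phi X Y => [l|p IHp q IHq|p IHp q IHq|v p IHp|v W p IHp] X Y XY.
- split=> /= [Xl t Yt|Yl s].
    by apply/emb_litP; apply: Xl; apply: projects_mem Yt.
  by case: XY => _ XY /XY[t Yt ->]; apply/emb_litP; apply: Yl.
- by rewrite /= (IHp X Y) // (IHq X Y).
- split=> /= [[X1 [X2 [U s1 s2]]]|[Y1 [Y2 [U s1 s2]]]].
    exists (lift_sub X1 Y), (lift_sub X2 Y); split.
    + exact: (lift_sub_union XY U).
    + case: U => d1 _ X12; rewrite -d1 -IHp //.
      by apply: projects_lift_sub XY _ _ => // s ?; apply/X12; left.
    + case: U => _ d2 X12; rewrite -d2 -IHq //.
      by apply: projects_lift_sub XY _ _ => // s ?; apply/X12; right.
  have [d1 d2 X12] := projects_union XY U.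
  exists (project Y1), (project Y2); split=> //.
  + by rewrite (IHp _ Y1) // d1.
  + by rewrite (IHq _ Y2) // d2.
- exact: (IHp (duplicate X v) _ (projects_duplicate v XY)).
- apply: slash_elimP => // X' Y' dX' XY'.
  by rewrite -dX'; apply: IHp.
Qed.

End IFToDependenceCorrect.

Theorem theorem3p3 (tau : vocabulary) (htau : at_most_binary tau) :
  (forall phi : dform tau 2, dep_width_le 2 phi -> dsentence phi ->
     exists2 phi' : ifform tau 2, ifsentence phi' &
       forall M : structure tau, dtrue M phi <-> iftrue M phi')
  /\
  (forall phi : ifform tau 2, ifsentence phi ->
     exists2 phi' : dform tau 3, dsentence phi' &
       forall M : structure tau, iftrue M phi <-> dtrue M phi').
Proof.
split=> [phi w2 sphi|phi sphi].
  (* Truth of a sentence is tested on the unit team, whose domain is empty; hence the initial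
     [set0]. *)
  exists (if_of_dep set0 phi) => [|M].
    by apply/eqP; rewrite -subset0; apply: if_of_dep_fr; rewrite sphi.
  by apply: (if_of_depP (X := unit_team (carrier M) 2)) => //; rewrite sphi.
exists (dep_of_if set0 phi) => [|M].
  apply/eqP; rewrite -subset0 -(imset0 (lift (@ord_max 2))).
  by apply: dep_of_if_fr; rewrite sphi.
exact: (dep_of_ifP phi (projects_unit 2 (carrier M))).
Qed.
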